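(* For every odd integer $n=2m+1\geq 3$, each of the polynomials $B_n^+(t)$ and $B_n^-(t)$ is a sum of two gamma positive polynomials.
   Context: $\mathfrak{B}_n$ is the group of signed permutations: bijections $\pi$ of $\{\pm1,\dots,\pm n\}$ with $\pi(-i)=-\pi(i)$; write $\pi_i=\pi(i)$ and $\pi_0=0$. $\mathsf{inv}_B(\pi)=|\{1\le i<j\le n:\pi_i>\pi_j\}|+|\{1\le i<j\le n:-\pi_i>\pi_j\}|+|\{i\in[n]:\pi_i<0\}|$; $\mathfrak{B}_n^+$ is the set of $\pi$ with $\mathsf{inv}_B(\pi)$ even, $\mathfrak{B}_n^-=\mathfrak{B}_n\setminus\mathfrak{B}_n^+$. $\mathsf{des}_B(\pi)=|\{i\in\{0,\dots,n-1\}:\pi_i>\pi_{i+1}\}|$. $B_n^{\pm}(t)=\sum_{\pi\in\mathfrak{B}_n^{\pm}}t^{\mathsf{des}_B(\pi)}$. For a nonzero polynomial $f(t)=\sum_{i=r}^{N}a_it^i$ with $a_r\neq0\neq a_N$: $f$ is palindromic if $a_{r+i}=a_{N-i}$ for $0\le i\le\lfloor (N-r)/2\rfloor$, and gamma positive if it is palindromic and $f(t)=\sum_{i=0}^{\lfloor (N-r)/2\rfloor}\gamma_i t^{r+i}(1+t)^{N-r-2i}$ with all $\gamma_i\geq 0$. *)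

(* Defs.v *)
From HB Require Import structures.
From mathcomp Require Import all_boot all_order all_algebra all_fingroup.

Set Implicit Arguments.
Unset Strict Implicit.
Unset Printing Implicit Defensive.

Import Order.TTheory GRing.Theory Num.Theory.
Local Open Scope ring_scope.

(* The set {±1, ..., ±n}: the pair (s, k) stands for k + 1 if s is false and  *)
(* for -(k + 1) if s is true.                                                 *)
Definition letter (n : nat) : finType := (bool * 'I_n)%type.

Definition letter_val (n : nat) (x : letter n) : int :=
  (-1) ^+ x.1 * (x.2.+1)%:Z.

Definition letter_opp (n : nat) (x : letter n) : letter n := (~~ x.1, x.2).

Definition signed_perms (n : nat) : {set {perm letter n}} :=
  [set p : {perm letter n} |
    [forall x, p (letter_opp x) == letter_opp (p x)]].

(* entry p k is pi_k for 1 <= k <= n, and pi_0 = 0; indices k > n are junk.   *)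
Definition entry (n : nat) (p : {perm letter n}) (k : nat) : int :=
  if k is k'.+1 then
    oapp (fun i : 'I_n => letter_val (p (false, i))) 0 (insub k')
  else 0.

(* The indices 1 <= i < j <= n are shifted to i, j : 'I_n.                    *)
Definition invB (n : nat) (p : {perm letter n}) : nat :=
  (#|[set ij : 'I_n * 'I_n |
       (ij.1 < ij.2)%N && (entry p ij.1.+1 > entry p ij.2.+1)%R]|
   + #|[set ij : 'I_n * 'I_n |
       (ij.1 < ij.2)%N && (- entry p ij.1.+1 > entry p ij.2.+1)%R]|
   + #|[set i : 'I_n | (entry p i.+1 < 0)%R]|)%N.

Definition desB (n : nat) (p : {perm letter n}) : nat :=
  #|[set i : 'I_n | entry p i > entry p i.+1]|.

Definition signed_perms_plus (n : nat) : {set {perm letter n}} :=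
  [set p in signed_perms n | ~~ odd (invB p)].

Definition signed_perms_minus (n : nat) : {set {perm letter n}} :=
  signed_perms n :\: signed_perms_plus n.

Definition Bplus (R : nzRingType) (n : nat) : {poly R} :=
  \sum_(p in signed_perms_plus n) 'X^(desB p).

Definition Bminus (R : nzRingType) (n : nat) : {poly R} :=
  \sum_(p in signed_perms_minus n) 'X^(desB p).

(* For nonzero f, low_deg f and high_deg f are the least and the greatest     *)
(* exponents (r and N below) with a nonzero coefficient.                      *)
Definition low_deg (R : nzRingType) (f : {poly R}) : nat :=
  find (fun c => c != 0) f.

Definition high_deg (R : nzRingType) (f : {poly R}) : nat := (size f).-1.

Definition palindromic (R : nzRingType) (f : {poly R}) : Prop :=
  let r := low_deg f in
  let N := high_deg f in
  f != 0 /\ forall i : nat, (i <= (N - r)./2)%N -> f`_(r + i) = f`_(N - i).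

Definition gamma_positive (R : numDomainType) (f : {poly R}) : Prop :=
  let r := low_deg f in
  let N := high_deg f in
  palindromic f /\
  exists g : 'I_((N - r)./2).+1 -> R,
    (forall i, 0 <= g i) /\
    f = \sum_(i < ((N - r)./2).+1)
          g i *: ('X^(r + i) * (1 + 'X) ^+ (N - r - i.*2)).

(* Main.v *)
Require Import Defs.
From HB Require Import structures.
From mathcomp Require Import all_boot all_order all_algebra all_fingroup.
From mathcomp Require Import zify ring.

Set Implicit Arguments.
Unset Strict Implicit.
Unset Printing Implicit Defensive.

Import Order.TTheory GRing.Theory Num.Theory.
Local Open Scope ring_scope.

(* Deleting the letter of largest absolute value shows that the polynomial
   B_n = B_n^+ + B_n^- satisfies
     B_(n+1) = (1 + (2n+1) t) B_n + 2 t (1 - t) B_n',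
   and that B_n^+ - B_n^- = (1 - t)^n, because insertions of n+1 and -(n+1) at
   the same place cancel except at the end of the word.  The recurrence gives
   B_n = sum_i 4^i c(n,i) t^i (1+t)^(n-2i) with c(n,i) natural numbers.
   Let n = 2m+1.  Then (1-t)^(2m) = ((1+t)^2 - 4t)^m expands in the basis
   t^i (1+t)^(2m-2i) with coefficients (-4)^i 'C(m,i), and c(n,i) >= 'C(m,i), so
     b = (B_n/(1+t) + (1-t)^(2m)) / 2  and  b' = (B_n/(1+t) - (1-t)^(2m)) / 2
   are gamma positive, while B_n^+ = b + t b' and B_n^- = b' + t b. *)

(** * Words of signed permutations *)

Definition insert (k : nat) (x : int) (w : seq int) : seq int :=
  take k w ++ x :: drop k w.

Lemma perm_insert k x w : perm_eq (insert k x w) (x :: w).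
Proof. by rewrite /insert perm_catC /= perm_cons perm_catC cat_take_drop. Qed.

(** A slot is a place for the new letter of largest absolute value together with its sign, [true]
    meaning negative. *)
Definition slots (n : nat) : seq (nat * bool) :=
  [seq (k, b) | k <- iota 0 n.+1, b <- [:: false; true]].

Arguments slots : simpl never.

Lemma mem_slots n q : (q \in slots n) = (q.1 <= n)%N.
Proof.
case: q => k b; apply/allpairsP/idP => [[[k' b'] [+ _ [-> _]]]|kn].
  by rewrite mem_iota.
by exists (k, b); split; [rewrite mem_iota | case: (b) |].
Qed.

Lemma uniq_slots n : uniq (slots n).
Proof.
by apply: allpairs_uniq => [||[? ?] [? ?]]; rewrite ?iota_uniq.
Qed.

Fixpoint signed_words (n : nat) : seq (seq int) :=
  if n is n'.+1 then
    [seq insert q.1 ((-1) ^+ nat_of_bool q.2 * n'.+1%:Z) w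
       | w <- signed_words n', q <- slots n']
  else [:: [::]].

Lemma absz_signed (b : bool) (k : nat) : `|((-1) ^+ b * k%:Z)%R|%N = k.
Proof. by rewrite abszMsign. Qed.

(** For the converse direction the word is cut at its letter of absolute value [n.+1]; the length of
    the prefix and the sign of that letter give the slot. *)
Lemma mem_signed_words n w :
  (w \in signed_words n) = perm_eq (map absz w) (iota 1 n).
Proof.
elim: n w => [|n IHn] w.
  by rewrite inE; apply/eqP/idP => [-> // | /perm_nilP]; case: w.
have iotaS : perm_eq (iota 1 n.+1) (n.+1 :: iota 1 n).
  by rewrite -(addn1 n) iotaD perm_catC add1n addn1.
apply/allpairsP/idP => [[[w' [k b]] [/= Hw' _ ->]]|Hw].
  rewrite IHn in Hw'.
  apply: perm_trans (perm_map _ (perm_insert _ _ _)) _.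
  by rewrite /= absz_signed perm_sym (perm_trans iotaS) // perm_cons perm_sym.
have /mapP[x xw xn] : n.+1 \in map absz w.
  by rewrite (perm_mem Hw) (perm_mem iotaS) inE eqxx.
case/splitPr: xw Hw => u v Hw.
have Huv : perm_eq (map absz (u ++ v)) (iota 1 n).
  rewrite -(perm_cons n.+1); apply: perm_trans (perm_trans Hw iotaS).
  by rewrite !map_cat /= -xn -cat_rcons -cats1 -cat1s !catA perm_cat2r perm_catC.
exists (u ++ v, (size u, x < 0)); split.
- by rewrite IHn.
- rewrite mem_slots /=; have := perm_size Huv.
  by rewrite size_map size_cat size_iota; lia.
- rewrite /insert /= take_size_cat // drop_size_cat //; congr (_ ++ _ :: _).
  by case: (ltrP x 0) xn => /=; lia.
Qed.

Lemma insert_filter (P : pred int) k x w :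
  all (predC P) w -> P x -> filter (predC P) (insert k x w) = w.
Proof.
move=> Pw Px; rewrite filter_cat /= Px /= -filter_cat cat_take_drop.
exact/all_filterP.
Qed.

Lemma insert_find (P : pred int) k x w :
  all (predC P) w -> P x -> (k <= size w)%N -> find P (insert k x w) = k.
Proof.
move=> Pw Px kw; rewrite find_cat /= Px addn0 size_takel // ifN //.
rewrite -all_predC; move: Pw; rewrite -{1}(cat_take_drop k w) all_cat.
by case/andP.
Qed.

Lemma signed_words_small n w :
  w \in signed_words n -> all (fun y : int => - n.+1%:Z < y < n.+1%:Z) w.
Proof.
rewrite mem_signed_words => Hw; apply/allP => y yw.
have : absz y \in iota 1 n by rewrite -(perm_mem Hw) map_f.
by rewrite mem_iota; lia.
Qed.

Lemma signed_words_size n w : w \in signed_words n -> size w = n.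
Proof.
by rewrite mem_signed_words => /perm_size; rewrite size_map size_iota.
Qed.

(** No other letter has absolute value [n.+1], so filtering it out recovers the word, searching for
    it recovers the place, and its value recovers the sign. *)
Lemma insert_inj n (k k' : nat) (b b' : bool) w w' :
  w \in signed_words n -> w' \in signed_words n -> (k <= n)%N -> (k' <= n)%N ->
  insert k ((-1) ^+ b * n.+1%:Z) w = insert k' ((-1) ^+ b' * n.+1%:Z) w' ->
  (w, (k, b)) = (w', (k', b')).
Proof.
move=> Hw Hw' kn k'n E; pose P := [pred x : int | absz x == n.+1].
have PW v : v \in signed_words n -> all (predC P) v.
  by move/signed_words_small; apply: sub_all => y /=; lia.
have PN (c : bool) : P ((-1) ^+ c * n.+1%:Z) by rewrite /= absz_signed.
have := congr1 (filter (predC P)) E; rewrite !insert_filter ?PW // => Ew.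
subst w'; have := congr1 (find P) E.
rewrite !insert_find ?PW ?(signed_words_size Hw) // => Ek; subst k'.
move/(congr1 (nth 0)): E => /(congr1 (fun f => f (size (take k w)))).
rewrite /insert !nth_cat !ltnn !subnn /= => Eb; congr (_, (_, _)).
by case: b b' Eb => [] [] //=; rewrite ?expr0 ?expr1; lia.
Qed.

Lemma uniq_signed_words n : uniq (signed_words n).
Proof.
elim: n => [//|n IHn]; apply: allpairs_uniq => //; first exact: uniq_slots.
move=> [w [k b]] [w' [k' b']] /allpairsP[[w1 q1] [Hw + [-> Eq]]].
rewrite -Eq mem_slots => kn /allpairsP[[w2 q2] [Hw' + [-> Eq']]].
by rewrite -Eq' mem_slots => k'n; apply: insert_inj.
Qed.

(** * Descents and inversions under insertion *)

Fixpoint desw (a : int) (w : seq int) : nat :=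
  if w is y :: w' then ((y < a)%R + desw y w')%N else 0%N.

Fixpoint invw (w : seq int) : nat :=
  if w is y :: w' then
    (count (fun z : int => z < y)%R w' + count (fun z : int => z < - y)%R w' + (y < 0)%R
     + invw w')%N
  else 0%N.

Lemma insert0 x w : insert 0 x w = x :: w.
Proof. by rewrite /insert take0 drop0. Qed.

Lemma insertS k x y w : insert k.+1 x (y :: w) = y :: insert k x w.
Proof. by []. Qed.

Lemma des_le_size a w : (desw a w <= size w)%N.
Proof. by elim: w a => //= y w IHw a; have := IHw y; lia. Qed.

(** A letter above all others keeps the number of descents when put into a descent or at the end,
    and adds one descent at every other place. *)
Lemma sum_insert_max (R : comNzRingType) (N : int) a w :
  a < N -> all (fun y : int => y < N) w ->
  \sum_(k < (size w).+1) 'X^(desw a (insert k N w)) =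
  'X^(desw a w) *+ (desw a w).+1
  + 'X^((desw a w).+1) *+ (size w - desw a w) :> {poly R}.
Proof.
elim: w a => [|y w IHw] a aN.
  rewrite big_ord1 insert0 /= => _.
  by rewrite (_ : (N < a) = false) ?addr0 //; lia.
rewrite [all _ _]/= => /andP[yN wN].
rewrite big_ord_recl insert0 /=.
rewrite (_ : (N < a) = false) ?yN; last by lia.
under eq_bigr => k _ do rewrite exprD.
rewrite -big_distrr /= IHw //; have := des_le_size y w.
move: (desw y w) (size w) => d l dl.
by case: (y < a); rewrite /= ?add0n ?add1n ?subSS ?(subSn dl) !exprS ?expr0; ring.
Qed.

(** A letter below all others adds a descent at the end too, so only the places inside a descent
    keep the count. *)
Lemma sum_insert_min (R : comNzRingType) (N : int) a w :
  N < a -> all (fun y : int => N < y) w ->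
  \sum_(k < (size w).+1) 'X^(desw a (insert k N w)) =
  'X^(desw a w) *+ desw a w
  + 'X^((desw a w).+1) *+ ((size w).+1 - desw a w) :> {poly R}.
Proof.
elim: w a => [|y w IHw] a aN.
  by rewrite big_ord1 insert0 /= => _; rewrite aN add0r.
rewrite [all _ _]/= => /andP[yN wN].
rewrite big_ord_recl insert0 /= aN.
rewrite (_ : (y < N) = false); last by lia.
under eq_bigr => k _ do rewrite exprD.
rewrite -big_distrr /= IHw //; have := des_le_size y w.
move: (desw y w) (size w) => d l dl.
case: (y < a); rewrite /= ?add0n ?add1n ?subSS ?(subSn dl) ?subSn ?leqW //.
  by rewrite !exprS ?expr0; ring.
by rewrite !exprS ?expr0; ring.
Qed.

Lemma inv_insert_max (N : int) k w :
  (k <= size w)%N -> 0 < N -> all (fun y : int => - N < y < N) w ->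
  invw (insert k N w) = (invw w + (size w - k))%N.
Proof.
move=> + N0; elim: w k => [|y w IHw] [|k] //.
- by move=> _ _; rewrite insert0 /=; lia.
- move: {IHw}(y :: w) => {y} w _ /allP wN; rewrite insert0 /=.
  rewrite (@eq_in_count _ _ predT) => [|z /wN /=]; last by lia.
  rewrite count_predT (@eq_in_count _ _ pred0 w) => [|z /wN /=]; last by lia.
  by rewrite count_pred0 (lt_gtF N0) !addn0 subn0 addnC.
move=> kw /andP[yN wN]; rewrite insertS /= IHw //.
by rewrite !(seq.permP (perm_insert k N w)) /=; lia.
Qed.

(** Each of the [k] letters on the left gives two new inversions, each letter on the right gives
    one, and the negative sign of the new letter gives one more. *)
Lemma inv_insert_min (N : int) k w :
  (k <= size w)%N -> 0 < N -> all (fun y : int => - N < y < N) w ->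
  invw (insert k (- N) w) = (invw w + (size w + k).+1)%N.
Proof.
move=> + N0; elim: w k => [|y w IHw] [|k] //.
- by move=> _ _; rewrite insert0 /=; lia.
- move: {IHw}(y :: w) => {y} w _ /allP wN; rewrite insert0 /=.
  rewrite (@eq_in_count _ _ pred0) => [|z /wN /=]; last by lia.
  rewrite count_pred0 (@eq_in_count _ _ predT w) => [|z /wN /=]; last by lia.
  by rewrite count_predT oppr_lt0 N0 add0n addn0 addn1 addnC.
move=> kw /andP[yN wN]; rewrite insertS /= IHw //.
by rewrite !(seq.permP (perm_insert k (- N) w)) /=; lia.
Qed.

(** When a letter follows, [N] makes a descent just after itself and [- N] one just before itself:
    exactly one in either case. *)
Lemma des_insert_opp (N : int) a k w :
  (k < size w)%N -> - N < a < N -> all (fun y : int => - N < y < N) w ->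
  desw a (insert k (- N) w) = desw a (insert k N w).
Proof.
elim: w a k => [|y w IHw] a [|k] // kw aN /andP[yN wN].
  by rewrite !insert0 /=; lia.
by rewrite !insertS /= IHw.
Qed.

Lemma des_insert_end (N : int) a w :
  - N < a < N -> all (fun y : int => - N < y < N) w ->
  desw a (insert (size w) N w) = desw a w /\
  desw a (insert (size w) (- N) w) = (desw a w).+1.
Proof.
elim: w a => [|y w IHw] a aN; first by rewrite !insert0 /=; lia.
by rewrite [all _ _]/= => /andP[yN /(IHw y yN)[IH1 IH2]];
  rewrite !insertS /= IH1 IH2 addnS.
Qed.

(** * Gamma expansions *)

Lemma coef_gamma_basis (R : comNzRingType) s d i k : (i.*2 <= d)%N ->
  ('X^(s + i) * (1 + 'X) ^+ (d - i.*2) : {poly R})`_k =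
  (if (k < s + i)%N then 0%N else 'C(d - i.*2, k - (s + i)))%:R.
Proof.
move=> id; rewrite coefXnM; case: ifP => // _.
rewrite exprDn coef_sum.
under eq_bigr => j _ do rewrite expr1n mul1r coefMn coefXn.
case: (ltnP (k - (s + i)) (d - i.*2).+1) => [lt|ge].
  rewrite (bigD1 (Ordinal lt)) //= big1 => [|j /eqP ji].
    by rewrite eqxx addr0.
  rewrite (_ : _ == _ = false) ?mul0rn //; apply/eqP => E; apply: ji.
  exact: val_inj.
rewrite bin_small ?big1 // => j _.
by rewrite (_ : _ == _ = false) ?mul0rn //; have := ltn_ord j; lia.
Qed.

(** Let [i0] be the least index with a nonzero coefficient. Every basis term is symmetric under k ->
    2s + d - k, so the lowest degree [s + i0] forces the highest degree [s + d - i0], and the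
    expansion required by [gamma_positive] is the given one started at [i0]. *)
Lemma gamma_positive_sum (R : numDomainType) (s d : nat) (c : nat -> R) :
  (forall i, (i <= d./2)%N -> 0 <= c i) ->
  (exists2 i, (i <= d./2)%N & c i != 0) ->
  gamma_positive
    (\sum_(i < d./2.+1) c i *: ('X^(s + i) * (1 + 'X) ^+ (d - i.*2))).
Proof.
move=> c_ge0 [i1 i1d ci1]; set f := \sum_(i < _) _.
have ex_c : exists i, (i <= d./2)%N && (c i != 0) by exists i1; apply/andP.
case: (ex_minnP ex_c) => i0 /andP[i0d ci0] i0_min.
have c0 i : (i < i0)%N -> c i = 0.
  move=> ii0; apply/eqP; apply/negPn/negP => ci.
  by have := i0_min i; rewrite ci; lia.
have coef_f k : f`_k = \sum_(i < d./2.+1)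
    c i * (if (k < s + i)%N then 0%N else 'C(d - i.*2, k - (s + i)))%:R.
  by rewrite coef_sum; apply: eq_bigr => i _; rewrite coefZ coef_gamma_basis //; have := ltn_ord i; lia.
have f_low k : (k < s + i0)%N -> f`_k = 0.
  move=> ki0; rewrite coef_f big1 // => i _.
  case: (ltnP i i0) => [/c0 -> |?]; first by rewrite mul0r.
  by rewrite ifT ?mulr0 //; lia.
have f_sym k : (k <= s.*2 + d)%N -> f`_k = f`_(s.*2 + d - k).
  move=> kd; rewrite !coef_f; apply: eq_bigr => i _; congr (_ * _%:R).
  have := ltn_ord i => ?.
  case: (ltnP k) => ?; case: (ltnP (s.*2 + d - k)) => ? //.
  - by rewrite bin_small //; lia.
  - by rewrite bin_small //; lia.
  - by rewrite -bin_sub; [congr 'C(_, _); lia | lia].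
have f_i0 : f`_(s + i0) = c i0.
  rewrite coef_f (bigD1 (Ordinal (i0d : (i0 < d./2.+1)%N))) //= ltnn subnn bin0.
  rewrite mulr1 big1 ?addr0 // => i /eqP ii0.
  case: (ltngtP i i0) => [/c0 -> |?|E]; first by rewrite mul0r.
    by rewrite ifT ?mulr0 //; lia.
  by case: ii0; apply: val_inj.
have f_hi k : (s + d - i0 < k)%N -> f`_k = 0.
  move=> ki0; case: (leqP k (s.*2 + d)) => [kd|kd].
    by rewrite f_sym // f_low //; lia.
  rewrite coef_f big1 // => i _; rewrite ifF ?bin_small ?mulr0 //; have := ltn_ord i; lia.
have size_f : size f = (s + d - i0).+1.
  apply/eqP; rewrite eqn_leq; apply/andP; split.
    by apply/leq_sizeP => k kd; exact: f_hi.
  rewrite ltnNge; apply/negP => /leq_sizeP /(_ (s + d - i0)%N (leqnn _)) E.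
  move: ci0; rewrite -f_i0 f_sym; last by lia.
  by rewrite (_ : _ - _ = s + d - i0)%N ?E ?eqxx //; lia.
have high_f : high_deg f = (s + d - i0)%N by rewrite /high_deg size_f.
have low_f : low_deg f = (s + i0)%N.
  rewrite /low_deg; have has_f : has (fun a => a != 0) f.
    by apply/(has_nthP 0); exists (s + i0)%N; rewrite ?f_i0 // size_f; lia.
  case: (ltngtP (find (fun a => a != 0) f) (s + i0)) => // lt.
    by have := nth_find 0 has_f; rewrite f_low ?eqxx.
  by have := before_find 0 lt; rewrite f_i0 ci0.
have half_f : (s + d - i0 - (s + i0) = d - i0.*2)%N by lia.
rewrite /gamma_positive /palindromic high_f low_f half_f.
split; first split.
- by apply: contraNneq ci0 => f0; rewrite -f_i0 f0 coef0.
- by move=> i id; rewrite f_sym; [congr _`_ _; lia | lia].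
exists (fun i : 'I_((d - i0.*2)./2).+1 => c (i0 + i)%N); split.
  by move=> i; apply: c_ge0; have := ltn_ord i; lia.
have E : (d./2.+1 = i0 + ((d - i0.*2)./2).+1)%N by lia.
rewrite /f -(big_mkord predT (fun i => c i *: ('X^(s + i) * (1 + 'X) ^+ (d - i.*2)))).
rewrite E big_mkord big_split_ord /= big1 ?add0r => [|i _]; last first.
  by rewrite c0 ?scale0r.
by apply: eq_bigr => i _; rewrite addnA doubleD subnDA.
Qed.

(* [4 ^ i * gamma_coef n i] are the gamma coefficients of the type B Eulerian
   polynomial; [gamma_coef n i] counts the permutations of [n] letters with
   [i] left peaks. *)
Fixpoint gamma_coef (n i : nat) : nat :=
  if n is n'.+1 then
    (i.*2.+1 * gamma_coef n' i
     + if i is j.+1 then (n' - j.*2) * gamma_coef n' j else 0)%N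
  else (i == 0)%N.

Lemma gamma_coef_eq0 n i : (n < i.*2)%N -> gamma_coef n i = 0%N.
Proof.
elim: n i => [|n IHn] [|i] //= ni; rewrite IHn ?muln0; last by lia.
(* Either [n < i.*2], or [n = i.*2] and the factor [n - i.*2] is zero. *)
by case: (ltnP n i.*2) => ?; [rewrite IHn ?muln0 | rewrite (_ : n - _ = 0)%N //; lia].
Qed.

(** Pascal's rule is compared with the recurrence. The factor [i.*2.+1] is at least 1, so the
    coefficients do not decrease with [n]; the factor [m.*2.+2 - i.*2] is positive for [i <= m]. *)
Lemma gamma_coef_ge_bin m i : (i <= m)%N -> ('C(m, i) <= gamma_coef m.*2.+1 i)%N.
Proof.
elim: m i => [|m IHm] [|i] // im.
  by have := IHm 0%N isT; rewrite !bin0 /=; lia.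
have le_succ j : (gamma_coef m.*2.+1 j <= gamma_coef m.*2.+2 j)%N.
  by rewrite -[X in (_ <= X)%N]/(gamma_coef m.*2.+1.+1 j) /=; lia.
rewrite binS doubleS -[gamma_coef _ _]/(i.+1.*2.+1 * gamma_coef m.*2.+2 i.+1
  + (m.*2.+2 - i.*2) * gamma_coef m.*2.+2 i)%N.
have H1 : ('C(m, i.+1) <= gamma_coef m.*2.+2 i.+1)%N.
  case: (ltnP i m) => [lt|?]; last by rewrite bin_small.
  exact: leq_trans (IHm _ lt) (le_succ _).
have H2 : ('C(m, i) <= gamma_coef m.*2.+2 i)%N.
  by apply: leq_trans (le_succ _); apply: IHm; lia.
apply: leq_add; first by apply: leq_trans H1 _; lia.
by apply: leq_trans H2 _; rewrite leq_pmull //; lia.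
Qed.

(** The operator is additive; its values on monomials match the insertion counts, and its values on
    the gamma basis give the recurrence of [gamma_coef]. *)
Definition eulerian_op (R : comNzRingType) (n : nat) (p : {poly R}) : {poly R} :=
  p + 'X * p *+ n.*2.+1 + (1 - 'X) * 'X * p^`() *+ 2.

(** The multiplicities are the totals of the two insertion counts, (d + 1) + d and (n - d) + (n + 1
    - d). *)
Lemma eulerian_opXn (R : comNzRingType) n d : (d <= n)%N ->
  eulerian_op n ('X^d : {poly R}) =
  'X^d *+ d.*2.+1 + 'X^(d.+1) *+ (n.*2.+1 - d.*2).
Proof.
move=> dn; rewrite /eulerian_op derivXn.
rewrite (_ : n.*2.+1 - d.*2 = (n - d).*2.+1)%N; last by lia.
rewrite -{1}(subnK dn); move: (n - d)%N => k.
case: d {dn} => [|d] /=; rewrite -?muln2 ?exprS; ring.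
Qed.

(** With e = n - 2i, factoring out t^i (1+t)^(e-1) leaves (1 + (2n+1) t)(1+t) + 2i (1-t)(1+t) + 2e t
    (1-t) = (2i+1)(1+t)^2 + 4e t. *)
Lemma eulerian_op_gamma (R : comNzRingType) n i : (i.*2 <= n)%N ->
  eulerian_op n ('X^i * (1 + 'X) ^+ (n - i.*2) : {poly R}) =
  ('X^i * (1 + 'X) ^+ (n.+1 - i.*2)) *+ i.*2.+1
  + ('X^(i.+1) * (1 + 'X) ^+ (n.+1 - i.+1.*2)) *+ (4 * (n - i.*2)).
Proof.
move=> inn; rewrite /eulerian_op derivM derivXn deriv_exp derivD derivX derivC add0r mul1r.
rewrite subSn // doubleS subSS -subnS.
have -> : (n.*2.+1 = (n - i.*2 + i.*2).*2.+1)%N by lia.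
(* The case split makes the predecessors in the exponents compute; when [n = i.*2] the truncated
   exponent is harmless because its term has coefficient 0. *)
rewrite subnS; case: (n - i.*2)%N => [|k]; case: i {inn} => [|i];
  rewrite -?muln2 -?pred_Sn ?exprS ?expr0; ring.
Qed.

Lemma eulerian_op_sum (R : comNzRingType) n (I : Type) (r : seq I) P
    (F : I -> {poly R}) :
  eulerian_op n (\sum_(i <- r | P i) F i) =
  \sum_(i <- r | P i) eulerian_op n (F i).
Proof.
rewrite /eulerian_op raddf_sum !mulr_sumr -!sumrMnl -!big_split /=.
by apply: eq_bigr.
Qed.

Lemma eulerian_opMn (R : comNzRingType) n (p : {poly R}) k :
  eulerian_op n (p *+ k) = eulerian_op n p *+ k.
Proof. by rewrite /eulerian_op derivMn; ring. Qed.

(** * Eulerian polynomials of words *)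

Lemma signed_wordsS n :
  signed_words n.+1 =
  [seq insert q.1 ((-1) ^+ nat_of_bool q.2 * n.+1%:Z) w
     | w <- signed_words n, q <- slots n].
Proof. by []. Qed.

Lemma sum_signed_wordsS (V : nmodType) n (F : seq int -> V) :
  \sum_(w <- signed_words n.+1) F w =
  \sum_(w <- signed_words n) \sum_(k < n.+1)
    (F (insert k n.+1%:Z w) + F (insert k (- n.+1%:Z) w)).
Proof.
rewrite signed_wordsS big_allpairs_dep; apply: eq_bigr => w _.
rewrite big_allpairs_dep -[iota 0 n.+1]/(index_iota 0 n.+1) big_mkord.
apply: eq_bigr => k _.
by rewrite !big_cons big_nil /= expr0 expr1 mul1r mulN1r addr0.
Qed.

Lemma sum_des_recurrence (R : comNzRingType) n :
  \sum_(w <- signed_words n.+1) 'X^(desw 0 w) =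
  eulerian_op n (\sum_(w <- signed_words n) 'X^(desw 0 w)) :> {poly R}.
Proof.
rewrite sum_signed_wordsS eulerian_op_sum; apply: eq_big_seq => w Hw.
have wN := signed_words_small Hw; have := des_le_size 0 w.
rewrite -(signed_words_size Hw) big_split /= in wN *.
have w_lt : all (fun y : int => y < (size w).+1%:Z) w.
  by apply: sub_all wN => y /andP[].
have w_gt : all (fun y : int => - (size w).+1%:Z < y) w.
  by apply: sub_all wN => y /andP[].
rewrite sum_insert_max // sum_insert_min //.
move: (desw 0 w) (size w) => d l dl; rewrite eulerian_opXn //.
rewrite (_ : l.*2.+1 - d.*2 = (l - d).*2.+1)%N; last by lia.
by rewrite (subSn dl) -!muln2; ring.
Qed.

(** At place k the letters n+1 and -(n+1) add n-k and n+k+1 inversions. The difference 2k+1 is odd,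
    so for k < n, where the descents agree, the two terms cancel; the end place contributes the
    factor 1 - t. *)
Lemma sum_sign_des (R : comNzRingType) n :
  \sum_(w <- signed_words n) (-1) ^+ invw w * 'X^(desw 0 w) =
  (1 - 'X) ^+ n :> {poly R}.
Proof.
elim: n => [|n IHn]; first by rewrite big_seq1 mul1r.
rewrite sum_signed_wordsS exprSr -IHn mulr_suml; apply: eq_big_seq => w Hw.
have := signed_words_small Hw; rewrite -(signed_words_size Hw) => wN.
have N0 : - (size w).+1%:Z < 0 < (size w).+1%:Z by lia.
have [Ep Em] := des_insert_end N0 wN.
rewrite big_ord_recr /= big1 ?add0r => [|k _].
  rewrite Ep Em inv_insert_max // inv_insert_min // subnn addn0.
  rewrite addnn addnS -[in X in _ + X]signr_odd oddS oddD odd_double addbF.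
  rewrite -[in X in X + _]signr_odd -[RHS]mulrA -(signr_odd _ (invw w)).
  by case: (odd (invw w)); rewrite /= ?exprS ?expr0; ring.
have kw := ltnW (ltn_ord k).
rewrite inv_insert_max // inv_insert_min // des_insert_opp //.
rewrite addnS (_ : invw w + (size w + k) = k.*2 + (invw w + (size w - k)))%N.
  by rewrite exprS (exprD _ k.*2) -(signr_odd _ k.*2) odd_double expr0; ring.
by move: (nat_of_ord k) kw => {k} k; move: (size w) => s kw; lia.
Qed.

Lemma sum_des_gamma (R : comNzRingType) n :
  \sum_(w <- signed_words n) 'X^(desw 0 w) =
  \sum_(i < n./2.+1)
    ('X^i * (1 + 'X) ^+ (n - i.*2)) *+ (4 ^ i * gamma_coef n i) :> {poly R}.
Proof.
pose G n i : {poly R} :=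
  ('X^i * (1 + 'X) ^+ (n - i.*2)) *+ (4 ^ i * gamma_coef n i).
(* Extending the sum adds only zero coefficients and removes the dependence on the parity of [k]. *)
have widen k : \sum_(i < k./2.+1) G k i = \sum_(i < k.+1) G k i.
  rewrite -!(big_mkord predT (G k)) [RHS](big_cat_nat (n := k./2.+1)) //=; last by lia.
  rewrite [X in _ + X]big_nat [X in _ + X]big1 ?addr0 // => i /andP[ik _].
  by rewrite /G gamma_coef_eq0 ?muln0 ?mulr0n //; lia.
rewrite -/(G _ _) widen; elim: n => [|n IHn].
  by rewrite big_seq1 big_ord1 /G /= mulr1.
rewrite sum_des_recurrence IHn eulerian_op_sum.
have opG i : eulerian_op n (G n i) =
    ('X^i * (1 + 'X) ^+ (n.+1 - i.*2)) *+ (4 ^ i * (i.*2.+1 * gamma_coef n i))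
    + ('X^(i.+1) * (1 + 'X) ^+ (n.+1 - i.+1.*2))
        *+ (4 ^ i.+1 * ((n - i.*2) * gamma_coef n i)).
  rewrite eulerian_opMn; case: (leqP i.*2 n) => [le|lt]; last first.
    by rewrite gamma_coef_eq0 // !muln0 !mulr0n addr0.
  rewrite eulerian_op_gamma // mulrnDl -!mulrnA expnS.
  by congr (_ *+ _ + _ *+ _); ring.
under eq_bigr => i _ do rewrite opG.
rewrite big_split /= [RHS]big_ord_recl.
rewrite [X in _ = _ + X](eq_bigr (fun i : 'I_n.+1 =>
    ('X^(i.+1) * (1 + 'X) ^+ (n.+1 - i.+1.*2))
      *+ (4 ^ i.+1 * (i.+1.*2.+1 * gamma_coef n i.+1))
    + ('X^(i.+1) * (1 + 'X) ^+ (n.+1 - i.+1.*2))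
        *+ (4 ^ i.+1 * ((n - i.*2) * gamma_coef n i)))); last first.
  by move=> i _; rewrite /G -mulrnDr -mulnDr.
rewrite big_split /= addrA; congr (_ + _).
rewrite big_ord_recl /=; congr (_ + _).
  by rewrite /G /= addn0.
(* The surplus last term carries [gamma_coef n n.+1], which is zero. *)
rewrite big_ord_recr /= gamma_coef_eq0 ?muln0 ?mulr0n ?addr0 //.
  by lia.
Qed.

(** * Signed permutations as words *)

Definition word (n : nat) (p : {perm letter n}) : seq int :=
  [seq entry p k.+1 | k <- iota 0 n].

Lemma size_word n (p : {perm letter n}) : size (word p) = n.
Proof. by rewrite size_map size_iota. Qed.

Lemma entry_letter n (p : {perm letter n}) (i : 'I_n) :
  entry p i.+1 = letter_val (p (false, i)).
Proof. by rewrite /entry valK. Qed.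

Lemma nth_word n (p : {perm letter n}) (i : nat) :
  (i < n)%N -> nth 0 (word p) i = entry p i.+1.
Proof. by move=> lt; rewrite (nth_map 0%N) ?size_iota // nth_iota. Qed.

Lemma absz_letter_val n (x : letter n) : absz (letter_val x) = x.2.+1.
Proof. by rewrite /letter_val abszMsign. Qed.

Lemma letter_val_inj n : injective (@letter_val n).
Proof.
move=> [b i] [b' i'] E.
have /= [Ei] : (b, i).2.+1 = (b', i').2.+1.
  by rewrite -[LHS]absz_letter_val E absz_letter_val.
have {}Ei : i = i' by exact: val_inj.
subst i'; congr (_, _); move: E; rewrite /letter_val /=.
by case: b; case: b' => //; rewrite expr0 expr1; lia.
Qed.

Lemma signed_permP n (p : {perm letter n}) b i : p \in signed_perms n ->
  p (b, i) = (b (+) (p (false, i)).1, (p (false, i)).2).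
Proof.
rewrite inE => /forallP /(_ (false, i)) /eqP.
by case: b => /= E; [exact: E | case: (p _)].
Qed.

Lemma word_signed_words n (p : {perm letter n}) :
  p \in signed_perms n -> word p \in signed_words n.
Proof.
move=> Hp; rewrite mem_signed_words.
have -> : map absz (word p) = [seq (p (false, i)).2.+1 | i <- enum 'I_n].
  rewrite /word -val_enum_ord -!map_comp; apply: eq_map => i.
  by rewrite -[RHS]absz_letter_val -entry_letter.
have inj : injective (fun i => (p (false, i)).2).
  move=> i j E; apply: contraTeq isT => ij.
  (* If the images of i and j agree up to sign, then i or -i has the same image as j, and
     injectivity of [p] gives i = j. *)
  have : p ((p (false, i)).1 (+) (p (false, j)).1, i) = p (false, j).
    by rewrite signed_permP // E -addbA addbCA addbb addbF; case: (p (false, j)).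
  by move/perm_inj => [_ E']; rewrite E' eqxx in ij.
rewrite (iotaDl 1 0) -val_enum_ord -map_comp.
rewrite (map_comp (fun i : 'I_n => i.+1) (fun i => (p (false, i)).2)).
apply: perm_map; apply: uniq_perm; first by rewrite map_inj_uniq ?enum_uniq.
  exact: enum_uniq.
move=> i; transitivity true; last by rewrite mem_enum.
apply/mapP; exists (invF inj i); first by rewrite mem_enum.
by have := f_invF inj i.
Qed.

Lemma word_inj n : {in signed_perms n &, injective (@word n)}.
Proof.
move=> p q Hp Hq E; apply/permP => -[b i].
have : p (false, i) = q (false, i).
  by apply: letter_val_inj; rewrite -!entry_letter -!nth_word // E.
by move=> Ei; rewrite (signed_permP b i Hp) (signed_permP b i Hq) Ei.
Qed.

Lemma word_surj n (w : seq int) : w \in signed_words n ->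
  exists2 p : {perm letter n}, p \in signed_perms n & word p = w.
Proof.
move=> Hw; have sz := signed_words_size Hw.
rewrite mem_signed_words in Hw.
have rng (i : 'I_n) : (0 < absz (nth 0%R w i) <= n)%N.
  have : absz (nth 0 w i) \in iota 1 n.
    by rewrite -(perm_mem Hw) map_f // mem_nth // sz.
  by rewrite mem_iota; lia.
have bnd (i : 'I_n) : ((absz (nth 0%R w i)).-1 < n)%N by have := rng i; lia.
(* The absolute value of the entry gives the index, lowered by one as in [letter]; the sign of the
   entry is multiplied by that of the argument. *)
pose f (x : letter n) : letter n :=
  (x.1 (+) (nth 0 w x.2 < 0), Ordinal (bnd x.2)).
have f_inj : injective f.
  move=> [b i] [b' j]; rewrite /f /= => -[Eb Ea].
  have {}Ea : nth 0%N (map absz w) i = nth 0%N (map absz w) j.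
    rewrite !(nth_map 0) ?sz //.
    have /andP[pi _] := rng i; have /andP[pj _] := rng j.
    by rewrite -(prednK pi) -(prednK pj) Ea.
  have {Ea} /eqP Eij : (i == j :> nat).
    move/eqP: Ea; rewrite nth_uniq ?size_map ?sz //.
    by rewrite (perm_uniq Hw) iota_uniq.
  by have {Eij} Eij := val_inj Eij; move: Eb; rewrite Eij => /addIb ->.
exists (perm f_inj).
  by rewrite inE; apply/forallP => x; rewrite !permE /f /letter_opp /= addNb.
apply: (@eq_from_nth _ 0) => [|i]; rewrite size_word ?sz // => lt.
rewrite nth_word // (entry_letter _ (Ordinal lt)) permE /letter_val /=.
have /= := rng (Ordinal lt).
by case: ltrP => /= ?; rewrite ?expr0 ?expr1; lia.
Qed.

Lemma sum_signed_perms (V : nmodType) n (F : seq int -> V) :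
  \sum_(p in signed_perms n) F (word p) = \sum_(w <- signed_words n) F w.
Proof.
rewrite -big_enum -(big_map (@word n) predT F) /=.
apply: perm_big; apply: uniq_perm; last 1 first.
- move=> w; apply/mapP/idP => [[p Hp ->]|/word_surj[p Hp <-]].
    by apply: word_signed_words; rewrite -mem_enum.
  by exists p; rewrite ?mem_enum.
- rewrite map_inj_in_uniq ?enum_uniq // => p q; rewrite !mem_enum.
  exact: word_inj.
- exact: uniq_signed_words.
Qed.

Lemma count_sum_nth (P : pred int) w :
  count P w = (\sum_(i < size w) P (nth 0%R w i))%N.
Proof.
elim: w => [|x w IHw]; first by rewrite big_ord0.
by rewrite big_ord_recl /= IHw.
Qed.

Lemma desw_sum a w :
  desw a w = (\sum_(i < size w) (nth 0 w i < nth 0 (a :: w) i)%R)%N.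
Proof.
elim: w a => [|x w IHw] a; first by rewrite big_ord0.
by rewrite big_ord_recl /= IHw.
Qed.

(** Separating the pairs with first index 0 mirrors one step of the recursion of [invw]. *)
Lemma sum_ltn_recl (s : nat) (F : nat -> nat -> bool) :
  (\sum_(i < s.+1) \sum_(j < s.+1) ((i < j) && F i j) =
   \sum_(j < s) F 0 j.+1 + \sum_(i < s) \sum_(j < s) ((i < j) && F i.+1 j.+1))%N.
Proof.
rewrite big_ord_recl big_ord_recl /= add0n; congr (_ + _)%N.
by apply: eq_bigr => i _; rewrite big_ord_recl.
Qed.

Lemma invw_sum w (z := nth 0 w) :
  invw w =
  (\sum_(i < size w) \sum_(j < size w) ((i < j) && (z j < z i)%R)
   + \sum_(i < size w) \sum_(j < size w) ((i < j) && (z j < - z i)%R)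
   + \sum_(i < size w) (z i < 0)%R)%N.
Proof.
rewrite {}/z; elim: w => [|x w IHw]; first by rewrite !big_ord0.
rewrite (sum_ltn_recl _ (fun i j => nth 0 (x :: w) j < nth 0 (x :: w) i)).
rewrite (sum_ltn_recl _ (fun i j => nth 0 (x :: w) j < - nth 0 (x :: w) i)).
rewrite big_ord_recl /= {}IHw !count_sum_nth.
by rewrite addnACA; congr (_ + _)%N; rewrite addnACA.
Qed.

Lemma desB_word n (p : {perm letter n}) : desB p = desw 0 (word p).
Proof.
rewrite desw_sum size_word /desB -sum1dep_card big_mkcond /=.
apply: eq_bigr => i _; rewrite nth_word //.
(* The prepended 0 plays the role of pi_0. *)
rewrite (_ : nth 0 (0 :: word p) i = entry p i); first by case: (_ < _).
case: i => -[|i] lt //=; rewrite nth_word //; exact: ltnW.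
Qed.

Lemma invB_word n (p : {perm letter n}) : invB p = invw (word p).
Proof.
rewrite invw_sum size_word /invB -!sum1dep_card !(big_mkcond (fun _ => _ && _)).
rewrite [in LHS](big_mkcond (fun i => _ < _)) /= !pair_big /=.
congr (_ + _ + _)%N; apply: eq_bigr => i _; rewrite ?nth_word //;
  by case: (X in if X then _ else _).
Qed.

(** * The two gamma positive summands *)

Lemma BplusDminus (R : comNzRingType) n :
  Bplus R n + Bminus R n = \sum_(w <- signed_words n) 'X^(desw 0 w).
Proof.
rewrite -(sum_signed_perms n (fun w => 'X^(desw 0 w))).
under [RHS]eq_bigr => p _ do rewrite -desB_word.
rewrite [RHS](big_setID (signed_perms_plus n)) /= (setIidPr _) //.
by apply/subsetP => p; rewrite inE => /andP[].
Qed.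

Lemma BplusBminus (R : comNzRingType) n :
  Bplus R n - Bminus R n = (1 - 'X) ^+ n.
Proof.
rewrite -sum_sign_des.
rewrite -(sum_signed_perms n (fun w => (-1) ^+ invw w * 'X^(desw 0 w))).
under [RHS]eq_bigr => p _ do rewrite -desB_word -invB_word -signr_odd.
rewrite [RHS](big_setID (signed_perms_plus n)) /= (setIidPr _); last first.
  by apply/subsetP => p; rewrite inE => /andP[].
rewrite /Bminus -sumrN; congr (_ + _); apply: eq_bigr => p.
  by rewrite inE => /andP[_ /negbTE ->]; rewrite mul1r.
rewrite !inE => /andP[+ Hp]; rewrite Hp /= negbK => ->.
by rewrite expr1 mulN1r.
Qed.

(* [half_poly R m s e] is [t ^ s (B_n / (1 + t) + (-1) ^ e (1 - t) ^ (2m)) / 2]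
   for [n = 2m + 1], written in the gamma basis. *)
Definition half_coef (R : realFieldType) (m : nat) (e : bool) (i : nat) : R :=
  4 ^+ i * ((gamma_coef m.*2.+1 i)%:R + (-1) ^+ (e + i) * 'C(m, i)%:R) / 2.

Definition half_poly (R : realFieldType) (m s : nat) (e : bool) : {poly R} :=
  \sum_(i < (m.*2)./2.+1)
    half_coef R m e i *: ('X^(s + i) * (1 + 'X) ^+ (m.*2 - i.*2)).

Lemma half_poly1 (R : realFieldType) m e :
  half_poly R m 1 e = 'X * half_poly R m 0 e.
Proof.
rewrite mulr_sumr; apply: eq_bigr => i _.
by rewrite exprS -scalerAr mulrA.
Qed.

(** The binomial parts of the coefficients have opposite signs and cancel; the factor 1 + t raises
    the exponents 2m - 2i to 2m + 1 - 2i. *)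
Lemma half_polyD (R : realFieldType) m :
  (1 + 'X) * (half_poly R m 0 false + half_poly R m 0 true) =
  Bplus R m.*2.+1 + Bminus R m.*2.+1.
Proof.
rewrite BplusDminus sum_des_gamma -big_split mulr_sumr /= uphalf_double doubleK.
apply: eq_bigr => i _; rewrite subSn; last by have := ltn_ord i; lia.
rewrite -scalerDl.
have -> : half_coef R m false i + half_coef R m true i =
          (4 ^ i * gamma_coef m.*2.+1 i)%:R.
  by rewrite /half_coef add0n add1n exprS natrM natrX; field.
by rewrite scaler_nat mulrnAr exprS mulrCA.
Qed.

Lemma gamma_positive_half_poly (R : realFieldType) m s e : (0 < m)%N ->
  gamma_positive (half_poly R m s e).
Proof.
move=> m0; apply: gamma_positive_sum => [i|].
  rewrite doubleK => im; rewrite /half_coef divr_ge0 ?mulr_ge0 ?exprn_ge0 //.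
  have : 'C(m, i)%:R <= (gamma_coef m.*2.+1 i)%:R :> R.
    by rewrite ler_nat gamma_coef_ge_bin.
  rewrite -signr_odd; case: odd; rewrite ?expr1 ?mulN1r ?subr_ge0 //.
  by rewrite mul1r addr_ge0.
(* At index [e] the sign (-1)^(e+e) is positive, and ['C(m, e)] is positive since [0 < m]. For m = 0
   and [e = true] the polynomial would be zero. *)
exists (nat_of_bool e); first by rewrite doubleK; case: e.
rewrite /half_coef addnn -signr_odd odd_double mul1r.
rewrite !mulf_neq0 ?expf_neq0 ?invr_eq0 ?pnatr_eq0 // -natrD pnatr_eq0.
by have : (0 < 'C(m, e))%N; [rewrite bin_gt0; case: e | lia].
Qed.

Lemma half_polyB (R : realFieldType) m :
  half_poly R m 0 false - half_poly R m 0 true = (1 - 'X) ^+ m.*2.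
Proof.
have -> : (1 - 'X : {poly R}) ^+ m.*2 = ((1 + 'X) ^+ 2 - 'X *+ 4) ^+ m.
  by rewrite -mul2n exprM; congr (_ ^+ _); ring.
rewrite -sumrB exprBn doubleK; apply: eq_bigr => i _.
rewrite -scalerBl.
have -> : half_coef R m false i - half_coef R m true i =
          (-1) ^+ i * (4 ^ i * 'C(m, i))%:R.
  by rewrite /half_coef add0n add1n exprS natrM natrX; field.
rewrite -scalerA scaler_nat exprMn_n -exprM mulnBr !mul2n mulrnAr -[RHS]mulrnA.
rewrite -[in RHS]mulrA ['X^i * _]mulrC -(signr_odd R) -(signr_odd {poly R}).
by case: odd; rewrite ?scaleN1r ?mulN1r ?scale1r ?mul1r ?mulNrn.
Qed.

(** This lets the decompositions be checked on the sum and the difference of the two polynomials,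
    both already computed. *)
Lemma eq_from_add_sub (R : numFieldType) (p q p' q' : {poly R}) :
  p + q = p' + q' -> p - q = p' - q' -> p = p'.
Proof.
move=> Ha Hs; apply: (@mulIf _ (2%:R)%:P); first by rewrite polyC_eq0 pnatr_eq0.
have -> : (2%:R)%:P = 1 + 1 :> {poly R} by rewrite -polyCD.
have -> : p * (1 + 1) = (p + q) + (p - q) by ring.
by rewrite Ha Hs; ring.
Qed.


Theorem theorem30 (R : realFieldType) (n : nat) (n_odd : odd n)
    (n_ge3 : (3 <= n)%N) :
  (exists f g : {poly R},
      [/\ gamma_positive f, gamma_positive g & Bplus R n = f + g]) /\
  (exists f g : {poly R},
      [/\ gamma_positive f, gamma_positive g & Bminus R n = f + g]).
Proof.
have [m -> m0] : exists2 m, n = m.*2.+1 & (0 < m)%N by exists n./2; lia.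
have HD := half_polyD R m; have HB := half_polyB R m.
have HS := BplusBminus R m.*2.+1; rewrite exprS -HB in HS.
split.
  (* The pair b + t b', b' + t b has sum (1+t)(b + b') and difference (1-t)(b - b'), as [HD] and
     [HS] require. *)
  exists (half_poly R m 0 false), (half_poly R m 1 true).
  split; try exact: gamma_positive_half_poly.
  apply: (eq_from_add_sub (q := Bminus R m.*2.+1)
    (q' := half_poly R m 0 true + 'X * half_poly R m 0 false)).
    by rewrite -HD half_poly1; ring.
  by rewrite HS half_poly1; ring.
exists (half_poly R m 0 true), (half_poly R m 1 false).
split; try exact: gamma_positive_half_poly.
apply: (eq_from_add_sub (q := Bplus R m.*2.+1)
  (q' := half_poly R m 0 false + 'X * half_poly R m 0 true)).
  by rewrite addrC -HD half_poly1; ring.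
by rewrite -opprB HS half_poly1; ring.
Qed.
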